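(* Let $\mathbf{k}$ be a field of characteristic different from $2$. For a $\mathbb{Z}_2\times\mathbb{Z}_2$-graded (bi-graded) Lie algebra $(\mathfrak g,[\cdot,\cdot])$ over $\mathbf{k}$ with bi-degree $\varepsilon=(\varepsilon_1,\varepsilon_2)$, equip the vector space $\mathfrak g$ with the parity $p=\varepsilon_1+\varepsilon_2\in\mathbb{Z}_2$, the bilinear operation determined by $$[a,b]_s:=(-1)^{\varepsilon_1(a)\varepsilon_2(b)}[a,b]\qquad\text{for all } a,b\in\mathfrak g \text{ of pure bi-degree},$$ and the linear map $\sigma:\mathfrak g\to\mathfrak g$ determined by $\sigma(v)=(-1)^{\varepsilon_2(v)}v$ for $v$ of pure bi-degree. Then $(\mathfrak g,p,[\cdot,\cdot]_s)$ is a Lie superalgebra and $\sigma$ is an involutive automorphism of it. The assignment $(\mathfrak g,\varepsilon,[\cdot,\cdot])\mapsto(\mathfrak g,p,[\cdot,\cdot]_s,\sigma)$, which is the identity on underlying linear maps of morphisms, is an equivalence between the category of bi-graded Lie algebras over $\mathbf{k}$ and the category of Lie superalgebras over $\mathbf{k}$ equipped with an involutive automorphism, where a morphism in the latter category is a morphism of Lie superalgebras that intertwines the involutions.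
   Context: Here $\mathbb{Z}_2=\mathbb{Z}/2\mathbb{Z}$. A bi-graded vector space is $V=\bigoplus_{(i,j)\in\mathbb{Z}_2\times\mathbb{Z}_2}V_{ij}$; nonzero elements of $V_{ij}$ have pure bi-degree $\varepsilon(v)=(\varepsilon_1(v),\varepsilon_2(v))=(i,j)$. Write $\varepsilon(v)\varepsilon(w):=\varepsilon_1(v)\varepsilon_1(w)+\varepsilon_2(v)\varepsilon_2(w)\in\mathbb{Z}_2$. A $\mathbb{Z}_2\times\mathbb{Z}_2$-graded (bi-graded) Lie algebra is a bi-graded vector space $\mathfrak g$ with a bilinear operation $[\cdot,\cdot]:\mathfrak g\times\mathfrak g\to\mathfrak g$ of bi-degree $(0,0)$ (i.e. $[\mathfrak g_\gamma,\mathfrak g_\delta]\subset\mathfrak g_{\gamma+\delta}$) such that, for elements of pure bi-degree, $[a,b]=-(-1)^{\varepsilon(a)\varepsilon(b)}[b,a]$ and $[a,[b,c]]=[[a,b],c]+(-1)^{\varepsilon(a)\varepsilon(b)}[b,[a,c]]$. A morphism of bi-graded Lie algebras is a linear map preserving bi-degrees and brackets. A Lie superalgebra is a $\mathbb{Z}_2$-graded vector space with parity $p$ and an even bilinear bracket such that, for elements of pure parity, $[a,b]=-(-1)^{p(a)p(b)}[b,a]$ and $[a,[b,c]]=[[a,b],c]+(-1)^{p(a)p(b)}[b,[a,c]]$. Morphisms of Lie superalgebras are parity-preserving linear maps preserving brackets. An involutive automorphism is a (parity-preserving) automorphism $\sigma$ with $\sigma^2=\mathrm{id}$ (the identity is allowed).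 *)

(* Defs.v *)
From HB Require Import structures.
From mathcomp Require Import all_boot all_algebra.
From mathcomp Require Import boolp.

Set Implicit Arguments.
Unset Strict Implicit.
Unset Printing Implicit Defensive.

Import GRing.Theory.
Local Open Scope ring_scope.

(* The library does not infer this join; it makes 'Z_2 * 'Z_2 a grading group. *)
HB.instance Definition _ (A B : finZmodType) := GRing.Zmodule.on (A * B)%type.

Record category := Category {
  obj :> Type;
  mor : obj -> obj -> Type;
  idm : forall a, mor a a;
  compm : forall a b c, mor b c -> mor a b -> mor a c;
  comp1m : forall a b (f : mor a b), compm (idm b) f = f;
  compm1 : forall a b (f : mor a b), compm f (idm a) = f;
  compmA : forall a b c d (f : mor c d) (g : mor b c) (h : mor a b),
    compm f (compm g h) = compm (compm f g) h
}.
Arguments idm {_} a.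
Arguments compm {_ _ _ _} f g.

Record functor (C D : category) := Functor {
  fobj :> C -> D;
  fmap : forall a b : C, mor a b -> mor (fobj a) (fobj b);
  fmap1 : forall a, fmap (idm a) = idm (fobj a);
  fmapM : forall a b c (f : mor b c) (g : mor a b),
    fmap (compm f g) = compm (fmap f) (fmap g)
}.
Arguments fmap {_ _} f {_ _} m : rename.

Definition functor_id (C : category) : functor C C.
Proof. by exists (fun a => a) (fun a b f => f). Defined.

Definition functor_comp (C D E : category) (G : functor D E) (F : functor C D) :
  functor C E.
Proof.
exists (fun a => G (F a)) (fun a b f => fmap G (fmap F f)).
- by move=> a; rewrite !fmap1.
- by move=> a b c f g; rewrite !fmapM.
Defined.

Record nat_iso (C D : category) (F G : functor C D) := NatIso {
  ni_fwd : forall a, mor (F a) (G a);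
  ni_bwd : forall a, mor (G a) (F a);
  ni_fwdK : forall a, compm (ni_bwd a) (ni_fwd a) = idm (F a);
  ni_bwdK : forall a, compm (ni_fwd a) (ni_bwd a) = idm (G a);
  ni_natural : forall a b (f : mor a b),
    compm (ni_fwd b) (fmap F f) = compm (fmap G f) (ni_fwd a)
}.

Definition is_equivalence (C D : category) (F : functor C D) : Prop :=
  exists G : functor D C,
    inhabited (nat_iso (functor_comp G F) (functor_id C)) /\
    inhabited (nat_iso (functor_comp F G) (functor_id D)).

Definition is_grading (k : fieldType) (I : finType) (V : lmodType k)
    (G : I -> {pred V}) : Prop :=
  (forall i, GRing.submod_closed (G i)) /\
  (forall v, exists! f : {ffun I -> V},
     (forall i, f i \in G i) /\ v = \sum_i f i).

Section Component.
Context (k : fieldType) (I : finType) (V : lmodType k) (G : I -> {pred V}).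
Context (gradG : is_grading G).

Lemma component_ex v :
  exists f : {ffun I -> V}, [forall i, f i \in G i] && (v == \sum_i f i).
Proof.
have [f [[fG ->] _]] := gradG.2 v.
by exists f; rewrite eqxx andbT; apply/forallP.
Qed.

Definition component (i : I) (v : V) : V := xchoose (component_ex v) i.

Lemma component_mem i v : component i v \in G i.
Proof. by have /andP[/forallP/(_ i)] := xchooseP (component_ex v). Qed.

Lemma component_sum v : v = \sum_i component i v.
Proof. by have /andP[_ /eqP] := xchooseP (component_ex v). Qed.

Lemma component_pure i j v :
  v \in G i -> component j v = if j == i then v else 0.
Proof.
move=> vG; have [f [_ funi]] := gradG.2 v.
pose h := [ffun j => if j == i then v else 0 : V].
have -> : component j v = f j.
  rewrite /component (funi (xchoose (component_ex v))) //; split.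
    by move=> l; apply: (component_mem l v).
  exact: (component_sum v).
rewrite (funi h) ?ffunE //; split.
  move=> l; rewrite ffunE; case: eqP => [->|_] //.
  by have [] := gradG.1 l.
rewrite (bigD1 i) //= ffunE eqxx big1 ?addr0 // => l /negPf ne.
by rewrite ffunE ne.
Qed.

End Component.

Section GradedLie.
Context (k : fieldType).

Definition sgn (i : 'Z_2) : k := (-1) ^+ nat_of_ord i.

(* Lie algebras graded by G, with Koszul sign (-1)^(pairing g d); bi-graded
   Lie algebras and Lie superalgebras are the two instances below.  No axiom
   beyond the graded antisymmetry and Jacobi identities is imposed, also when
   k has characteristic 3. *)
Record is_graded_lie (Gr : finZmodType) (pairing : Gr -> Gr -> 'Z_2)
    (V : lmodType k) (deg : Gr -> {pred V}) (br : V -> V -> V) : Prop := {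
  lie_grading : is_grading deg;
  lie_bilinear : bilinear_for *:%R *:%R br;
  lie_degree : forall g d a b,
    a \in deg g -> b \in deg d -> br a b \in deg (g + d);
  lie_antisym : forall g d a b, a \in deg g -> b \in deg d ->
    br a b = - (sgn (pairing g d) *: br b a);
  lie_jacobi : forall g d h a b c,
    a \in deg g -> b \in deg d -> c \in deg h ->
    br a (br b c) = br (br a b) c + sgn (pairing g d) *: br b (br a c)
}.

Record graded_lie (Gr : finZmodType) (pairing : Gr -> Gr -> 'Z_2) := GradedLie {
  lie_car :> lmodType k;
  lie_deg : Gr -> {pred lie_car};
  lie_br : lie_car -> lie_car -> lie_car;
  lieP : is_graded_lie pairing lie_deg lie_br
}.
Arguments lie_deg {Gr pairing} g : rename.
Arguments lie_br {Gr pairing} g : rename.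

Section Morphisms.
Context (Gr : finZmodType) (pairing : Gr -> Gr -> 'Z_2).
Implicit Types A B C : graded_lie pairing.

Record is_lie_mor A B (f : A -> B) : Prop := {
  lie_mor_linear : linear f;
  lie_mor_degree : forall g v, v \in lie_deg A g -> f v \in lie_deg B g;
  lie_mor_br : forall a b, f (lie_br A a b) = lie_br B (f a) (f b)
}.

Record lie_mor A B := LieMor {
  lie_fun :> A -> B;
  lie_funP : is_lie_mor lie_fun
}.

Lemma lie_mor_eq A B (f g : lie_mor A B) : (lie_fun f = lie_fun g) -> f = g.
Proof.
case: f g => [f fP] [g gP] /= fg; case: _ / fg gP => gP.
by rewrite (Prop_irrelevance fP gP).
Qed.

Lemma is_lie_mor_id A : @is_lie_mor A A id.
Proof. by split. Qed.

Lemma is_lie_mor_comp A B C (f : B -> C) (g : A -> B) :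
  is_lie_mor f -> is_lie_mor g -> is_lie_mor (f \o g).
Proof.
case=> fl fd fb [gl gd gb]; split=> /=.
- by move=> a u v /=; rewrite gl fl.
- by move=> h v /gd /fd.
- by move=> a b; rewrite gb fb.
Qed.

Definition lie_id A : lie_mor A A := LieMor (is_lie_mor_id A).
Definition lie_comp A B C (f : lie_mor B C) (g : lie_mor A B) : lie_mor A C :=
  LieMor (is_lie_mor_comp (lie_funP f) (lie_funP g)).

Definition graded_lie_cat : category.
Proof.
by exists (graded_lie pairing) lie_mor lie_id lie_comp => *; apply: lie_mor_eq.
Defined.

End Morphisms.

Definition bipairing (g d : 'Z_2 * 'Z_2) : 'Z_2 := g.1 * d.1 + g.2 * d.2.
Definition spairing (p q : 'Z_2) : 'Z_2 := p * q.

Definition is_bigraded_lie := is_graded_lie bipairing.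
Definition bigraded_lie := graded_lie bipairing.
Definition bigraded_lie_cat : category := graded_lie_cat bipairing.

Definition is_superlie := is_graded_lie spairing.
Definition superlie := graded_lie spairing.

(* Bijectivity is implied by [involutive], and the inverse is s itself. *)
Definition is_involutive_aut (A : superlie) (s : A -> A) : Prop :=
  is_lie_mor s /\ involutive s.
Arguments is_involutive_aut A s : clear implicits.

Record superlie_inv := SuperlieInv {
  si_car :> graded_lie spairing;
  si_inv : si_car -> si_car;
  si_invP : is_involutive_aut si_car si_inv
}.
Arguments si_inv s : clear implicits.

Record is_superlie_inv_mor (A B : superlie_inv) (f : A -> B) : Prop := {
  si_mor_lie : is_lie_mor f;
  si_mor_inv : forall v, f (si_inv A v) = si_inv B (f v)
}.
Arguments is_superlie_inv_mor A B f : clear implicits.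

Record superlie_inv_mor (A B : superlie_inv) := SuperlieInvMor {
  si_fun :> A -> B;
  si_funP : is_superlie_inv_mor A B si_fun
}.

Lemma si_mor_eq (A B : superlie_inv) (f g : superlie_inv_mor A B) :
  si_fun f = si_fun g -> f = g.
Proof.
case: f g => [f fP] [g gP] /= fg; case: _ / fg gP => gP.
by rewrite (Prop_irrelevance fP gP).
Qed.

Lemma is_si_mor_id (A : superlie_inv) : is_superlie_inv_mor A A id.
Proof. by split=> //; apply: is_lie_mor_id. Qed.

Lemma is_si_mor_comp (A B C : superlie_inv) (f : B -> C) (g : A -> B) :
  is_superlie_inv_mor B C f -> is_superlie_inv_mor A B g ->
  is_superlie_inv_mor A C (f \o g).
Proof.
move=> [fl fi] [gl gi]; split; first exact: is_lie_mor_comp.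
by move=> v /=; rewrite gi fi.
Qed.

Definition si_id (A : superlie_inv) : superlie_inv_mor A A :=
  SuperlieInvMor (is_si_mor_id A).
Definition si_comp (A B C : superlie_inv)
    (f : superlie_inv_mor B C) (g : superlie_inv_mor A B) :
    superlie_inv_mor A C :=
  SuperlieInvMor (is_si_mor_comp (si_funP f) (si_funP g)).

Definition superlie_inv_cat : category.
Proof.
by exists superlie_inv superlie_inv_mor si_id si_comp => *; apply: si_mor_eq.
Defined.

Section Twist.
Context (A : bigraded_lie).

Local Notation comp_ := (component (lie_grading (lieP A))).

(* Bigraded components of v with g.1 + g.2 <> p must vanish, i.e.
   the part of parity p is the direct sum of the V_g with g.1 + g.2 = p. *)
Definition twist_parity (p : 'Z_2) : {pred A} :=
  [pred v | v == \sum_(g : 'Z_2 * 'Z_2 | g.1 + g.2 == p) comp_ g v].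

Definition twist_br (a b : A) : A :=
  \sum_(g : 'Z_2 * 'Z_2) \sum_(d : 'Z_2 * 'Z_2)
    sgn (g.1 * d.2) *: lie_br A (comp_ g a) (comp_ d b).

Definition twist_inv (v : A) : A :=
  \sum_(g : 'Z_2 * 'Z_2) sgn g.2 *: comp_ g v.

Lemma twist_parity_pure g v : v \in lie_deg A g -> v \in twist_parity (g.1 + g.2).
Proof.
move=> vg; rewrite inE (bigD1 g) //= (component_pure _ _ vg) eqxx.
by rewrite big1 ?addr0 // => d /andP[_ /negPf ne]; rewrite (component_pure _ _ vg) ne.
Qed.

Lemma twist_br_pure g d a b : a \in lie_deg A g -> b \in lie_deg A d ->
  twist_br a b = sgn (g.1 * d.2) *: lie_br A a b.
Proof.
move=> ag bd; have [brl brr] := lie_bilinear (lieP A).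
have br0 u : lie_br A u 0 = 0.
  by have := brr u (-1) 0 0; rewrite /= scaler0 addr0 scaleN1r addNr.
have b0r u : lie_br A 0 u = 0.
  by have := brl u (-1) 0 0; rewrite /= scaler0 addr0 scaleN1r addNr.
rewrite /twist_br (bigD1 g) //= (bigD1 d) //=.
rewrite (component_pure _ _ ag) (component_pure _ _ bd) !eqxx.
rewrite big1 ?addr0 => [|h /negPf ne].
  rewrite big1 ?addr0 // => h /negPf ne; rewrite big1 // => l _.
  by rewrite (component_pure _ _ ag) ne b0r scaler0.
by rewrite (component_pure _ _ bd) ne br0 scaler0.
Qed.

Lemma twist_inv_pure g v : v \in lie_deg A g -> twist_inv v = sgn g.2 *: v.
Proof.
move=> vg; rewrite /twist_inv (bigD1 g) //= (component_pure _ _ vg) eqxx.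
by rewrite big1 ?addr0 // => d /negPf ne; rewrite (component_pure _ _ vg) ne scaler0.
Qed.

End Twist.
Arguments twist_parity A p : clear implicits.
Arguments twist_br A a b : clear implicits.
Arguments twist_inv A v : clear implicits.

(* Well-definedness on objects and on morphisms is kept as hypotheses Hs, Hi
   and Hm; only the resulting underlying data matter, by proof irrelevance. *)
Section TwistFunctor.
Context (Hs : forall A : bigraded_lie, is_superlie (twist_parity A) (twist_br A)).

Definition twist_superlie (A : bigraded_lie) : superlie := GradedLie (Hs A).

Context (Hi : forall A : bigraded_lie,
  is_involutive_aut (twist_superlie A) (twist_inv A)).

Definition twist_obj (A : bigraded_lie) : superlie_inv := SuperlieInv (Hi A).

Context (Hm : forall (A B : bigraded_lie) (f : lie_mor A B),
  is_superlie_inv_mor (twist_obj A) (twist_obj B) (lie_fun f)).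

Definition twist_mor (A B : bigraded_lie) (f : lie_mor A B) :
    superlie_inv_mor (twist_obj A) (twist_obj B) :=
  SuperlieInvMor (Hm f).

Definition twist_functor : functor bigraded_lie_cat superlie_inv_cat.
Proof.
by exists (twist_obj : bigraded_lie_cat -> superlie_inv_cat) twist_mor => *;
  apply: si_mor_eq.
Defined.

End TwistFunctor.

End GradedLie.

Arguments twist_parity {k} A p.
Arguments twist_br {k} A a b.
Arguments twist_inv {k} A v.
Arguments is_involutive_aut {k} A s.
Arguments is_superlie_inv_mor {k} A B f.

(* Main.v *)
Require Import Defs.
From mathcomp Require Import all_boot all_algebra ring.

(** Why twisting is an equivalence.  The functor is a composite of two
operations, each of which can be undone.

The first is the sign change of the bracket.  Let [c] be a biadditive pairing
on the grading group with values in Z/2.  Multiplying the bracket by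
[(-1)^c(a,b)] on pure elements turns a Lie algebra for the Koszul pairing [P]
into one for [P + c + c^T]: in the Jacobi identity all three terms acquire the
same sign [(-1)^(c(a,b) + c(a,e) + c(b,e))], up to the discrepancy
[(-1)^(c(a,b) + c(b,a))] in the last term, which is the change of the pairing
([is_graded_lie_twist]).  For [c(g,d) = g1 d2] and the bi-graded pairing
[g1 d1 + g2 d2] the new pairing is [(g1 + g2) (d1 + d2)], that is, the super
pairing of the parities.  Since signs square to one, the same twist brings the
original bracket back ([sign_twistK]).

The second is the passage between the Z/2 x Z/2 grading and the parity with an
involution.  As the new pairing depends on parities only, the identities of
pure elements extend additively to parity-homogeneous ones
([is_graded_lie_coarsen]).  Conversely, away from characteristic 2 the
involution splits each parity component into its eigenspaces for 1 and -1
([is_grading_eigen_deg]), and the sign of the eigenvalue gives [g2], hence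
[g1] from the parity.

The inverse functor therefore refines the parity by eigenvalues and twists.
Both composites keep the underlying space; their degrees are the original ones
because a grading cannot be properly contained in another one
([grading_sub_eq]), and their brackets and involutions agree with the original
ones on pure elements, hence everywhere.  So identity maps are the natural
isomorphisms. *)

Set Implicit Arguments.
Unset Strict Implicit.
Unset Printing Implicit Defensive.

Import GRing.Theory.
Local Open Scope ring_scope.

Arguments lie_deg {k Gr pairing} g _.
Arguments lie_br {k Gr pairing} g _ _.
Arguments si_inv {k} s _.

(** * Signs and linear maps *)

Section Prelim.
Context (k : fieldType).

Lemma Z2P (i : 'Z_2) : i = 0 \/ i = 1.
Proof.
by case: i => [[|[|//]] lt]; [left|right]; apply: val_inj.
Qed.

Lemma sgnD (i j : 'Z_2) : sgn k (i + j) = sgn k i * sgn k j.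
Proof.
by case: (Z2P i) (Z2P j) => -> [] ->;
  rewrite /sgn /= ?expr0 ?expr1 ?mul1r ?mulr1 ?mulrNN ?mulr1.
Qed.

Lemma sgnM_self (i : 'Z_2) : sgn k i * sgn k i = 1.
Proof.
by case: (Z2P i) => ->; rewrite /sgn /= ?expr0 ?expr1 ?mulr1 ?mulrNN ?mulr1.
Qed.

Context (U V : lmodType k) (f : U -> V) (flin : linear f).

Lemma lin0 : f 0 = 0.
Proof. by have := flin (-1) 0 0; rewrite scaler0 addr0 scaleN1r addNr. Qed.

Lemma linD u v : f (u + v) = f u + f v.
Proof. by have := flin 1 u v; rewrite !scale1r. Qed.

Lemma linZ a u : f (a *: u) = a *: f u.
Proof. by have := flin a u 0; rewrite !addr0 lin0 addr0. Qed.

Lemma lin_sum (I : Type) (r : seq I) (P : pred I) (F : I -> U) :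
  f (\sum_(i <- r | P i) F i) = \sum_(i <- r | P i) f (F i).
Proof. exact: (big_morph f linD lin0). Qed.

End Prelim.

(** * Gradings *)

Section Grading.
Context (k : fieldType) (I : finType) (V : lmodType k) (G : I -> {pred V}).

(** Uniqueness of decompositions is read off by applying the projections to an
arbitrary decomposition. *)
Lemma is_grading_proj (pi : I -> V -> V) :
    (forall i, GRing.submod_closed (G i)) ->
    (forall i, linear (pi i)) ->
    (forall i v, pi i v \in G i) ->
    (forall v, v = \sum_i pi i v) ->
    (forall i j v, v \in G i -> pi j v = if j == i then v else 0) ->
  is_grading G.
Proof.
move=> Gsub pilin piG pisum pipure; split=> // v.
exists [ffun i => pi i v]; split.
  split=> [i|]; first by rewrite ffunE.
  by rewrite {1}(pisum v); apply: eq_bigr => i _; rewrite ffunE.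
move=> f [fG ->]; apply/ffunP => i; rewrite ffunE (lin_sum (pilin i)).
rewrite (bigD1 i) //= (pipure i) // eqxx big1 ?addr0 // => j /negPf ne.
by rewrite (pipure j) // eq_sym ne.
Qed.

Context (gradG : is_grading G).
Local Notation comp_ := (component gradG).

Lemma component_unique (f : I -> V) i :
  (forall j, f j \in G j) -> comp_ i (\sum_j f j) = f i.
Proof.
move=> fG; set v := \sum_j f j.
have [h [_ huni]] := gradG.2 v.
have e1 : h = [ffun j => f j].
  apply: huni; split=> [j|]; first by rewrite ffunE.
  by apply: eq_bigr => j _; rewrite ffunE.
have -> : comp_ i v = [ffun j => comp_ j v] i by rewrite ffunE.
rewrite -(huni [ffun j => comp_ j v]); first by rewrite e1 ffunE.
split=> [j|]; first by rewrite ffunE component_mem.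
by rewrite {1}(component_sum gradG v); apply: eq_bigr => j _; rewrite ffunE.
Qed.

Lemma component_linear i : linear (comp_ i).
Proof.
move=> a u v.
rewrite {1}(component_sum gradG u) {1}(component_sum gradG v).
rewrite scaler_sumr -big_split /=.
rewrite (component_unique (f := fun j => a *: comp_ j u + comp_ j v)) // => j.
by have [_ ->] := gradG.1 j; rewrite ?component_mem.
Qed.

Lemma pureZ i a v : v \in G i -> a *: v \in G i.
Proof.
by move=> vG; have [G0 GD] := gradG.1 i; rewrite -[_ *: _]addr0 GD.
Qed.

Lemma grading_ind (P : V -> Prop) :
    P 0 -> (forall u v, P u -> P v -> P (u + v)) ->
    (forall i v, v \in G i -> P v) ->
  forall v, P v.
Proof.
move=> P0 PD PG v; rewrite (component_sum gradG v).
by apply: (big_ind P) => // i _; apply: PG (component_mem gradG i v).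
Qed.

Lemma linear_ext (W : lmodType k) (f g : V -> W) : linear f -> linear g ->
  (forall i v, v \in G i -> f v = g v) -> f =1 g.
Proof.
move=> flin glin; apply: grading_ind => [|u v fu fv]; first by rewrite !lin0.
by rewrite (linD flin) (linD glin) fu fv.
Qed.

Lemma bilinear_ext (W : lmodType k) (f g : V -> V -> W) :
    bilinear_for *:%R *:%R f -> bilinear_for *:%R *:%R g ->
    (forall i j u v, u \in G i -> v \in G j -> f u v = g u v) ->
  f =2 g.
Proof.
move=> [fl fr] [gl gr] fg u v.
apply: (linear_ext (fl v) (gl v)) => i {}u uG.
by apply: (linear_ext (fr u) (gr u)) => j {}v vG; apply: fg uG vG.
Qed.

End Grading.

(** Decomposing [v] in the smaller grading gives a decomposition in the larger
one; for [v] pure in the latter, uniqueness makes [v] its own component in the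
former. *)
Lemma grading_sub_eq (k : fieldType) (I : finType) (V : lmodType k)
    (G G' : I -> {pred V}) (gradG : is_grading G) (gradG' : is_grading G') :
    (forall i v, v \in G i -> v \in G' i) ->
  forall i, G i =i G' i.
Proof.
move=> GG' i v; apply/idP/idP=> [|vG']; first exact: GG'.
have e : component gradG' i (\sum_j component gradG j v) = component gradG i v.
  by apply: component_unique => j; apply/GG'/component_mem.
rewrite -component_sum (component_pure _ _ vG') eqxx in e.
by rewrite e component_mem.
Qed.

(** * Coarsening a grading along a map of indices *)

Section Coarsen.
Context (k : fieldType) (I J : finType) (phi : I -> J) (V : lmodType k).
Context (G : I -> {pred V}) (gradG : is_grading G).
Local Notation comp_ := (component gradG).

Definition coarsen (p : J) : {pred V} :=
  [pred v | v == \sum_(i | phi i == p) comp_ i v].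

Lemma coarsen_sub p : GRing.submod_closed (coarsen p).
Proof.
have clin := component_linear gradG.
split=> [|a u v]; rewrite !inE.
  by rewrite big1 // => i _; rewrite (lin0 (clin i)).
move=> /eqP eu /eqP ev; rewrite {1}eu {1}ev scaler_sumr -big_split /=.
by apply/eqP/eq_bigr => i _; rewrite clin.
Qed.

Lemma coarsen0 p : 0 \in coarsen p.
Proof. by have [] := coarsen_sub p. Qed.

Lemma coarsenD p u v :
  u \in coarsen p -> v \in coarsen p -> u + v \in coarsen p.
Proof.
by move=> uG vG; have [_ GD] := coarsen_sub p; rewrite -[u]scale1r GD.
Qed.

Lemma coarsen_pure i v : v \in G i -> v \in coarsen (phi i).
Proof.
move=> vG; rewrite inE (bigD1 i) //= (component_pure _ _ vG) eqxx.
rewrite big1 ?addr0 // => j /andP[_ /negPf ne].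
by rewrite (component_pure _ _ vG) ne.
Qed.

Lemma coarsen_ind p (P : V -> Prop) :
    P 0 -> (forall u v, P u -> P v -> P (u + v)) ->
    (forall i v, phi i = p -> v \in G i -> P v) ->
  forall v, v \in coarsen p -> P v.
Proof.
move=> P0 PD PG v; rewrite inE => /eqP ->.
by apply: (big_ind P) => // i /eqP e; apply: PG e (component_mem gradG i v).
Qed.

Lemma is_grading_coarsen : is_grading coarsen.
Proof.
have clin := component_linear gradG.
apply: (is_grading_proj
  (pi := fun p v => \sum_(i | phi i == p) comp_ i v)).
- exact: coarsen_sub.
- move=> p a u v; rewrite scaler_sumr -big_split /=.
  by apply: eq_bigr => i _; rewrite clin.
- move=> p v; apply: (big_ind (fun w => w \in coarsen p)) => [|u w|i /eqP <-].
  + exact: coarsen0.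
  + exact: coarsenD.
  + exact: coarsen_pure (component_mem gradG i v).
- move=> v; rewrite {1}(component_sum gradG v).
  by rewrite (partition_big phi predT) //; apply: eq_bigr.
move=> p q v vG; case: eqP => [->|/eqP ne].
  by move: vG; rewrite inE => /eqP <-.
apply: big1 => i /eqP eiq.
move: v vG; apply: coarsen_ind => [|u w eu ew|j w ejp wG].
- by rewrite (lin0 (clin i)).
- by rewrite (linD (clin i)) eu ew addr0.
rewrite (component_pure _ _ wG); case: eqP => // eij.
by rewrite -eiq eij ejp eqxx in ne.
Qed.

End Coarsen.

(** Both identities are additive in each argument as soon as the signs depend
only on the coarse degrees, so checking them on finely homogeneous elements
is enough. *)
Lemma is_graded_lie_coarsen (k : fieldType) (Gr H : finZmodType)
    (phi : Gr -> H) (P : H -> H -> 'Z_2) (V : lmodType k)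
    (deg : Gr -> {pred V}) (br : V -> V -> V)
    (gradV : is_grading deg) :
    (forall g d, phi (g + d) = phi g + phi d) ->
    is_graded_lie (fun g d => P (phi g) (phi d)) deg br ->
  is_graded_lie P (coarsen phi gradV) br.
Proof.
move=> phiD [_ bil degbr anti jac]; have [brl brr] := bil.
have br0l w : br 0 w = 0 := lin0 (brl w).
have br0r w : br w 0 = 0 := lin0 (brr w).
have brDl w u v : br (u + v) w = br u w + br v w := linD (brl w) u v.
have brDr w u v : br w (u + v) = br w u + br w v := linD (brr w) u v.
split=> //.
- exact: is_grading_coarsen.
- move=> p q a b aG bG.
  move: a aG; apply: coarsen_ind => [|u v|g a eg aG]; rewrite ?br0l ?brDl //.
  + exact: coarsen0.
  + exact: coarsenD.
  move: b bG; apply: coarsen_ind => [|u v|d b ed bG]; rewrite ?br0r ?brDr //.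
  + exact: coarsen0.
  + exact: coarsenD.
  by rewrite -eg -ed -phiD; apply/coarsen_pure/degbr.
- move=> p q a b aG bG.
  move: a aG; apply: coarsen_ind => [|u v eu ev|g a <- aG].
  + by rewrite br0l br0r scaler0 oppr0.
  + by rewrite brDl brDr eu ev scalerDr opprD.
  move: b bG; apply: coarsen_ind => [|u v eu ev|d b <- bG].
  + by rewrite br0l br0r scaler0 oppr0.
  + by rewrite brDl brDr eu ev scalerDr opprD.
  exact: anti.
move=> p q r a b c aG bG cG.
move: a aG; apply: coarsen_ind => [|u v eu ev|g a <- aG].
- by rewrite !(br0l, br0r) scaler0 addr0.
- by rewrite !(brDl, brDr) eu ev scalerDr addrACA.
move: b bG; apply: coarsen_ind => [|u v eu ev|d b <- bG].
- by rewrite !(br0l, br0r) scaler0 addr0.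
- by rewrite !(brDl, brDr) eu ev scalerDr addrACA.
move: c cG; apply: coarsen_ind => [|u v eu ev|h c _ cG].
- by rewrite !br0r scaler0 addr0.
- by rewrite !brDr eu ev scalerDr addrACA.
exact: jac aG bG cG.
Qed.

(** * Twisting a bracket by signs *)

Section SignTwist.
Context (k : fieldType) (I : finType) (V : lmodType k).
Context (G : I -> {pred V}) (gradG : is_grading G) (c : I -> I -> 'Z_2).
Context (br : V -> V -> V) (bil : bilinear_for *:%R *:%R br).
Local Notation comp_ := (component gradG).

Definition sign_twist (a b : V) : V :=
  \sum_i \sum_j sgn k (c i j) *: br (comp_ i a) (comp_ j b).

Lemma sign_twist_bilinear : bilinear_for *:%R *:%R sign_twist.
Proof.
have clin := component_linear gradG.
have brl w a u v : br (a *: u + v) w = a *: br u w + br v w := bil.1 w a u v.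
have brr w a u v : br w (a *: u + v) = a *: br w u + br w v := bil.2 w a u v.
split=> w a u v /=; rewrite /sign_twist scaler_sumr -big_split /=;
  apply: eq_bigr => i _; rewrite scaler_sumr -big_split /=;
  apply: eq_bigr => j _; rewrite (clin _ a) /=.
  by rewrite brl scalerDr !scalerA mulrC.
by rewrite brr scalerDr !scalerA mulrC.
Qed.

Lemma sign_twist_pure i j a b : a \in G i -> b \in G j ->
  sign_twist a b = sgn k (c i j) *: br a b.
Proof.
have [brl brr] := bil => ai bj.
rewrite /sign_twist (bigD1 i) //= (bigD1 j) //=.
rewrite (component_pure _ _ ai) (component_pure _ _ bj) !eqxx.
rewrite [X in _ + X + _]big1 => [|l /negPf ne]; last first.
  by rewrite (component_pure _ _ bj) ne (lin0 (brr _)) scaler0.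
rewrite [X in _ + X]big1 ?addr0 // => l /negPf ne; rewrite big1 // => h _.
by rewrite (component_pure _ _ ai) ne (lin0 (brl _)) scaler0.
Qed.

End SignTwist.

Lemma sign_twist_morph (k : fieldType) (I : finType) (V W : lmodType k)
    (G : I -> {pred V}) (H : I -> {pred W})
    (gradG : is_grading G) (gradH : is_grading H) (c : I -> I -> 'Z_2)
    (brV : V -> V -> V) (brW : W -> W -> W) (f : V -> W) :
    bilinear_for *:%R *:%R brV -> bilinear_for *:%R *:%R brW -> linear f ->
    (forall i v, v \in G i -> f v \in H i) ->
    (forall a b, f (brV a b) = brW (f a) (f b)) ->
  forall a b, f (sign_twist gradG c brV a b) =
              sign_twist gradH c brW (f a) (f b).
Proof.
move=> bilV bilW flin fdeg fbr a b.
have [tVl tVr] := sign_twist_bilinear gradG c bilV.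
have [tWl tWr] := sign_twist_bilinear gradH c bilW.
move: a b; apply: (bilinear_ext gradG).
- split=> w a u v /=; rewrite -flin; congr f; first exact: tVl.
  exact: tVr.
- split=> w a u v /=; rewrite flin; first exact: tWl.
  exact: tWr.
move=> i j u v uG vG; rewrite (sign_twist_pure gradG c bilV uG vG).
rewrite (sign_twist_pure gradH c bilW (fdeg _ _ uG) (fdeg _ _ vG)).
by rewrite (linZ flin) fbr.
Qed.

(** The second twist may use another grading: [gradG] and [gradG'] only have to
assign the same degree to the elements that are pure for [gradG], since the
two signs then cancel. *)
Lemma sign_twistK (k : fieldType) (I : finType) (V : lmodType k)
    (G G' : I -> {pred V}) (gradG : is_grading G) (gradG' : is_grading G')
    (c : I -> I -> 'Z_2) (br : V -> V -> V) :
    bilinear_for *:%R *:%R br -> (forall i v, v \in G i -> v \in G' i) ->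
  sign_twist gradG' c (sign_twist gradG c br) =2 br.
Proof.
move=> bil GG'; have bil1 := sign_twist_bilinear gradG c bil.
apply: (bilinear_ext gradG) => //; first exact: sign_twist_bilinear.
move=> i j u v uG vG.
rewrite (sign_twist_pure gradG' c bil1 (GG' _ _ uG) (GG' _ _ vG)).
by rewrite (sign_twist_pure gradG c bil uG vG) scalerA sgnM_self scale1r.
Qed.

(** The sign [c g h + c d h + c g d] is common to the first two terms of the
Jacobi identity, and the third one differs from it by [c g d + c d g], which is
absorbed by the change of pairing. *)
Lemma is_graded_lie_twist (k : fieldType) (Gr : finZmodType)
    (P Q c : Gr -> Gr -> 'Z_2) (V : lmodType k) (deg : Gr -> {pred V})
    (br : V -> V -> V) (gradV : is_grading deg) :
    (forall g d h, c (g + d) h = c g h + c d h) ->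
    (forall g d h, c g (d + h) = c g d + c g h) ->
    (forall g d, Q g d = P g d + c g d + c d g) ->
    is_graded_lie P deg br ->
  is_graded_lie Q deg (sign_twist gradV c br).
Proof.
move=> cDl cDr QE [_ bil degbr anti jac].
have tw := sign_twist_pure gradV c bil.
have brZl a u w : br (a *: u) w = a *: br u w := linZ (bil.1 w) a u.
have brZr a u w : br w (a *: u) = a *: br w u := linZ (bil.2 w) a u.
split=> //.
- exact: sign_twist_bilinear.
- by move=> g d a b ag bd; rewrite (tw _ _ _ _ ag bd);
  apply/(pureZ gradV)/degbr.
- move=> g d a b ag bd; rewrite (tw _ _ _ _ ag bd) (tw _ _ _ _ bd ag).
  rewrite (anti _ _ _ _ ag bd) QE !sgnD scalerN !scalerA.
  congr (- (_ *: _)).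
  by rewrite -[RHS]mulrA sgnM_self mulr1 mulrC.
move=> g d h a b e ag bd eh.
have bracket_in g1 d1 a1 b1 : a1 \in deg g1 -> b1 \in deg d1 ->
  sgn k (c g1 d1) *: br a1 b1 \in deg (g1 + d1).
  by move=> *; apply/(pureZ gradV)/degbr.
rewrite (tw _ _ _ _ bd eh) (tw _ _ _ _ ag bd) (tw _ _ _ _ ag eh).
rewrite (tw _ _ _ _ ag (bracket_in _ _ _ _ bd eh)).
rewrite (tw _ _ _ _ (bracket_in _ _ _ _ ag bd) eh).
rewrite (tw _ _ _ _ bd (bracket_in _ _ _ _ ag eh)).
rewrite !brZr brZl (jac _ _ _ _ _ _ ag bd eh) QE !cDl !cDr !sgnD.
rewrite !scalerA scalerDr !scalerA; congr (_ *: _ + _ *: _).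
  by ring.
set s := sgn k (c d g); have ss : s * s = 1 := sgnM_self k _.
ring: ss.
Qed.

(** * Refining a parity by the eigenspaces of an involution *)

Section Refine.
Context (k : fieldType) (hk : 2%N \notin [pchar k]).
Context (V : lmodType k) (deg : 'Z_2 -> {pred V}) (gradV : is_grading deg).
Context (s : V -> V) (slin : linear s) (sK : involutive s).
Context (sdeg : forall p v, v \in deg p -> s v \in deg p).
Local Notation comp_ := (component gradV).

Definition eigen_deg (g : 'Z_2 * 'Z_2) : {pred V} :=
  [pred v | (v \in deg (g.1 + g.2)) && (s v == sgn k g.2 *: v)].

Lemma eigen_degP g v :
  reflect (v \in deg (g.1 + g.2) /\ s v = sgn k g.2 *: v) (v \in eigen_deg g).
Proof. by rewrite inE; apply: (iffP andP) => -[? /eqP]. Qed.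

(** The projection onto the eigenspace of an involution [s] for [e = 1] or
[e = -1] is
[(1 + e s) / 2]. *)
Definition eigen_proj (g : 'Z_2 * 'Z_2) (v : V) : V :=
  2^-1 *: (comp_ (g.1 + g.2) v + sgn k g.2 *: s (comp_ (g.1 + g.2) v)).

Lemma two_neq0 : 2 != 0 :> k.
Proof. by move: hk; rewrite inE. Qed.

Lemma half_double (v : V) : 2^-1 *: (v + v) = v.
Proof. by rewrite -mulr2n -scaler_nat scalerA mulVf ?scale1r // two_neq0. Qed.

Lemma is_grading_eigen_deg : is_grading eigen_deg.
Proof.
have clin p a u v : comp_ p (a *: u + v) = a *: comp_ p u + comp_ p v.
  exact: component_linear.
have linE a u v : s (a *: u + v) = a *: s u + s v by apply: slin.
have s0 : s 0 = 0 := lin0 slin.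
have sD u v : s (u + v) = s u + s v := linD slin u v.
have sZ a u : s (a *: u) = a *: s u := linZ slin a u.
apply: (is_grading_proj (pi := eigen_proj)).
- move=> g; have [deg0 degD] := gradV.1 (g.1 + g.2); split=> [|a u v].
    by apply/eigen_degP; rewrite s0 scaler0.
  move=> /eigen_degP[ug us] /eigen_degP[vg vs]; apply/eigen_degP.
  by rewrite degD // linE us vs scalerDr !scalerA mulrC.
- move=> g a u v; rewrite /eigen_proj clin linE !scalerDr !scalerA.
  by rewrite addrACA ![_ * a]mulrC !mulrA.
- move=> g v; set w := comp_ (g.1 + g.2) v.
  have wg : w \in deg (g.1 + g.2) := component_mem gradV _ v.
  apply/eigen_degP; rewrite /eigen_proj -/w; split.
    have [deg0 degD] := gradV.1 (g.1 + g.2).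
    by apply: (pureZ gradV); rewrite addrC degD ?sdeg.
  rewrite sZ sD sZ sK scalerA mulrC -scalerA; congr (_ *: _).
  by rewrite scalerDr scalerA sgnM_self scale1r addrC.
- move=> v; rewrite /eigen_proj.
  (* Sum over the parity p = i + j instead of i; for fixed p the terms with s
     cancel between j = 0 and j = 1. *)
  rewrite -(pair_bigA _ (fun i j : 'Z_2 => 2^-1 *:
    (comp_ (i + j) v + sgn k j *: s (comp_ (i + j) v)))) /=.
  rewrite exchange_big /=.
  under eq_bigr => j _ do rewrite (reindex_inj (addIr (- j))) /=.
  rewrite exchange_big {1}(component_sum gradV v); apply: eq_bigr => p _ /=.
  under eq_bigr => j _ do rewrite subrK.
  rewrite -scaler_sumr !big_ord_recl big_ord0 addr0 /sgn /=.
  by rewrite expr0 expr1 scale1r scaleN1r addrACA subrr addr0 half_double.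
move=> g d v /eigen_degP[vg vs]; rewrite /eigen_proj (component_pure _ _ vg).
case: eqP => [e|ne]; last first.
  rewrite s0 scaler0 addr0 scaler0; case: eqP => // e.
  by rewrite e in ne.
rewrite vs scalerA; case: eqP => [->|ne].
  by rewrite sgnM_self scale1r half_double.
have {ne e}: d.2 != g.2.
  apply: contra_notN ne => /eqP e2; move: e; rewrite e2 => /addIr.
  by case: d g e2 {vg vs} => [??] [??] /= -> ->.
by case: (Z2P d.2) (Z2P g.2) => -> [] -> //;
  rewrite /sgn /= expr0 expr1 ?mul1r ?mulr1 scaleN1r subrr scaler0.
Qed.

End Refine.

(** * From bi-graded Lie algebras to Lie superalgebras *)

Definition parity (g : 'Z_2 * 'Z_2) : 'Z_2 := g.1 + g.2.

(** The exponent of the sign in the twist: its symmetrization is the difference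
between the super pairing of parities and the bi-graded pairing. *)
Definition cross_pairing (g d : 'Z_2 * 'Z_2) : 'Z_2 := g.1 * d.2.

Lemma parityD g d : parity (g + d) = parity g + parity d.
Proof. exact: addrACA. Qed.

Lemma cross_pairingDl g d h :
  cross_pairing (g + d) h = cross_pairing g h + cross_pairing d h.
Proof. exact: mulrDl. Qed.

Lemma cross_pairingDr g d h :
  cross_pairing g (d + h) = cross_pairing g d + cross_pairing g h.
Proof. exact: mulrDr. Qed.

Lemma Z2_addrr (i : 'Z_2) : i + i = 0.
Proof. by case: (Z2P i) => ->; apply: val_inj. Qed.

Lemma spairing_parity g d : spairing (parity g) (parity d) =
  bipairing g d + cross_pairing g d + cross_pairing d g.
Proof. rewrite /spairing /parity /bipairing /cross_pairing; ring. Qed.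

(** The previous identity read backwards in characteristic 2: the same twist
leads from the super pairing to the bi-graded one. *)
Lemma bipairing_parity g d : bipairing g d =
  spairing (parity g) (parity d) + cross_pairing g d + cross_pairing d g.
Proof.
rewrite spairing_parity [X in X + _]addrAC.
by rewrite -(addrA (bipairing g d)) Z2_addrr addr0 -addrA Z2_addrr addr0.
Qed.

Section Twist.
Context (k : fieldType).

Lemma twist_is_superlie (A : bigraded_lie k) :
  is_superlie (twist_parity A) (twist_br A).
Proof.
apply: (is_graded_lie_coarsen (phi := parity) (lie_grading (lieP A)) parityD).
apply: (is_graded_lie_twist (P := @bipairing) (lie_grading (lieP A))
         cross_pairingDl cross_pairingDr spairing_parity).
exact: lieP.
Qed.

Lemma twist_inv_linear (A : bigraded_lie k) : linear (twist_inv A).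
Proof.
move=> a u v; rewrite /twist_inv scaler_sumr -big_split /=.
apply: eq_bigr => g _; rewrite (component_linear _ _ a) scalerDr.
by rewrite !scalerA mulrC.
Qed.

Lemma twist_br_bilinear (A : bigraded_lie k) :
  bilinear_for *:%R *:%R (twist_br A).
Proof. exact: sign_twist_bilinear (lie_bilinear (lieP A)). Qed.

Lemma twist_is_involutive_aut (A : bigraded_lie k) :
  is_involutive_aut (twist_superlie twist_is_superlie A) (twist_inv A).
Proof.
pose grad := lie_grading (lieP A).
have ilin := @twist_inv_linear A.
have degZ := pureZ grad.
split.
  split=> //=.
  - move=> p v; move: v; apply: coarsen_ind => [|u v|g v <- vg].
    + by rewrite (lin0 ilin); exact: coarsen0.
    + by rewrite (linD ilin); exact: coarsenD.
    + rewrite (twist_inv_pure vg); apply: (coarsen_pure parity grad).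
      exact: degZ.
  have [brl brr] := twist_br_bilinear A.
  apply: (bilinear_ext grad).
  - split=> w a u v /=; rewrite -ilin; congr twist_inv; first exact: brl.
    exact: brr.
  - split=> w a u v /=; rewrite ilin; first exact: brl.
    exact: brr.
  move=> g d u v ug vd; rewrite (twist_br_pure ug vd) (linZ ilin).
  rewrite (twist_inv_pure (lie_degree (lieP A) ug vd)).
  rewrite (twist_inv_pure ug) (twist_inv_pure vd).
  rewrite (twist_br_pure (degZ _ _ _ ug) (degZ _ _ _ vd)).
  rewrite (linZ ((lie_bilinear (lieP A)).1 _)).
  rewrite (linZ ((lie_bilinear (lieP A)).2 _)).
  by rewrite sgnD !scalerA.
apply: (linear_ext grad) => [a u v|a u v|g v vg]; rewrite ?ilin //.
rewrite (twist_inv_pure vg) (linZ ilin) (twist_inv_pure vg) scalerA.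
by rewrite sgnM_self scale1r.
Qed.

Lemma twist_is_mor (A B : bigraded_lie k) (f : lie_mor A B) :
  is_superlie_inv_mor (twist_obj twist_is_involutive_aut A)
    (twist_obj twist_is_involutive_aut B) (lie_fun f).
Proof.
have [flin fdeg fbr] := lie_funP f.
pose gradA := lie_grading (lieP A); pose gradB := lie_grading (lieP B).
split=> /=; last first.
  apply: (linear_ext gradA) => [a u v|a u v|g v vg].
  - by rewrite (@twist_inv_linear _ a) flin.
  - by rewrite flin (@twist_inv_linear _ a).
  by rewrite (twist_inv_pure vg) (linZ flin) (twist_inv_pure (fdeg _ _ vg)).
split=> //=; last first.
  exact: (sign_twist_morph _ _ _ (lie_bilinear (lieP A))
            (lie_bilinear (lieP B)) flin fdeg fbr).
move=> p v; move: v; apply: coarsen_ind => [|u v|g v <- vg].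
- by rewrite (lin0 flin); exact: coarsen0.
- by rewrite (linD flin); exact: coarsenD.
exact: (coarsen_pure parity gradB (fdeg _ _ vg)).
Qed.

End Twist.

(** * The inverse functor *)

Section Untwist.
Context (k : fieldType) (hk : 2%N \notin [pchar k]).

Definition untwist_deg (S : superlie_inv k) : 'Z_2 * 'Z_2 -> {pred S} :=
  eigen_deg (lie_deg S) (si_inv S).
Arguments untwist_deg : clear implicits.

Lemma untwist_grading (S : superlie_inv k) : is_grading (untwist_deg S).
Proof.
have [[slin sdeg _] sK] := si_invP S.
exact: (is_grading_eigen_deg hk (lie_grading (lieP S)) slin sK sdeg).
Qed.

Definition untwist_br (S : superlie_inv k) : S -> S -> S :=
  sign_twist (untwist_grading S) cross_pairing (lie_br S).
Arguments untwist_br : clear implicits.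

(** The superalgebra identities hold in particular for elements of the refined
grading, with signs computed from parities; [s] being an automorphism,
eigenvalues multiply under the bracket. *)
Lemma untwist_is_bigraded_lie (S : superlie_inv k) :
  is_bigraded_lie (untwist_deg S) (untwist_br S).
Proof.
apply: (is_graded_lie_twist (P := fun g d => spairing (parity g) (parity d))
  (untwist_grading S) cross_pairingDl cross_pairingDr bipairing_parity).
have [[slin _ sbr] _] := si_invP S.
have [_ bil degbr anti jac] := lieP S.
split=> //.
- exact: untwist_grading.
- move=> g d a b /eigen_degP[ag sa] /eigen_degP[bd sb]; apply/eigen_degP; split.
    by rewrite -/(parity _) parityD degbr.
  by rewrite sbr sa sb (linZ (bil.1 _)) (linZ (bil.2 _)) scalerA sgnD.
- by move=> g d a b /eigen_degP[ag _] /eigen_degP[bd _]; apply: anti.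
by move=> g d h a b c /eigen_degP[ag _] /eigen_degP[bd _] /eigen_degP[ch _];
  apply: jac ag bd ch.
Qed.

Definition untwist_obj (S : superlie_inv k) : bigraded_lie k :=
  GradedLie (untwist_is_bigraded_lie S).

Lemma untwist_is_mor (S T : superlie_inv k) (f : superlie_inv_mor S T) :
  is_lie_mor (si_fun f : untwist_obj S -> untwist_obj T).
Proof.
have [[flin fdeg fbr] finv] := si_funP f.
have udeg g v : v \in untwist_deg S g -> f v \in untwist_deg T g.
  move=> /eigen_degP[vg vs]; apply/eigen_degP; split; first exact: fdeg.
  by rewrite -finv vs (linZ flin).
split=> //=.
exact: (sign_twist_morph _ _ _ (lie_bilinear (lieP S))
          (lie_bilinear (lieP T)) flin udeg fbr).
Qed.

Definition untwist_mor (S T : superlie_inv k) (f : superlie_inv_mor S T) :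
  lie_mor (untwist_obj S) (untwist_obj T) := LieMor (untwist_is_mor f).

Definition untwist_functor : functor (superlie_inv_cat k) (bigraded_lie_cat k).
Proof.
by exists (untwist_obj : superlie_inv_cat k -> bigraded_lie_cat k) untwist_mor
  => *; apply: lie_mor_eq.
Defined.

Local Notation twist_ := (twist_obj (@twist_is_involutive_aut k)).

(** An element of degree [g] has parity [parity g] and eigenvalue [sgn g.2];
this inclusion of gradings is an equality. *)
Lemma untwist_twist_deg (A : bigraded_lie k) g v :
  (v \in untwist_deg (twist_ A) g) = (v \in lie_deg A g).
Proof.
pose grad := lie_grading (lieP A).
have sub h w : w \in lie_deg A h -> w \in untwist_deg (twist_ A) h.
  move=> wh; apply/eigen_degP; split; last exact: twist_inv_pure.
  exact: (coarsen_pure parity grad wh).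
by rewrite (grading_sub_eq grad (untwist_grading (twist_ A)) sub).
Qed.

Lemma untwist_twist_br (A : bigraded_lie k) :
  untwist_br (twist_ A) =2 lie_br A.
Proof.
apply: sign_twistK => [|g v vg]; first exact: lie_bilinear (lieP A).
by rewrite untwist_twist_deg.
Qed.

(** Every element of the refined grading with parity [p] lies in the component
of [p], so the coarsened grading is contained in the original one. *)
Lemma twist_untwist_deg (S : superlie_inv k) p v :
  (v \in twist_parity (untwist_obj S) p) = (v \in lie_deg S p).
Proof.
have sub q w : w \in twist_parity (untwist_obj S) q -> w \in lie_deg S q.
  have [cl0 clD] := (lie_grading (lieP S)).1 q.
  move: w; apply: coarsen_ind => [|u w uG wG|g w <-].
  - exact: cl0.
  - by rewrite -[u]scale1r clD.
  - by case/eigen_degP.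
have gradp := is_grading_coarsen parity (lie_grading (lieP (untwist_obj S))).
by rewrite (grading_sub_eq gradp (lie_grading (lieP S)) sub).
Qed.

Lemma twist_untwist_br (S : superlie_inv k) :
  twist_br (untwist_obj S) =2 lie_br S.
Proof. by apply: sign_twistK => //; apply: lie_bilinear (lieP S). Qed.

Lemma twist_untwist_inv (S : superlie_inv k) :
  twist_inv (untwist_obj S) =1 si_inv S.
Proof.
have [[slin _ _] _] := si_invP S.
apply: (linear_ext (untwist_grading S)) => //.
  exact: (@twist_inv_linear k (untwist_obj S)).
move=> g v vg; rewrite (@twist_inv_pure _ (untwist_obj S) g) //.
by case/eigen_degP: vg.
Qed.

End Untwist.

Theorem proposition1 (k : fieldType) (hk : 2%N \notin [pchar k]%R) :
  exists (Hs : forall A : bigraded_lie k,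
            is_superlie (twist_parity A) (twist_br A))
         (Hi : forall A : bigraded_lie k,
            is_involutive_aut (twist_superlie Hs A) (twist_inv A))
         (Hm : forall (A B : bigraded_lie k) (f : lie_mor A B),
            is_superlie_inv_mor (twist_obj Hi A) (twist_obj Hi B) (lie_fun f)),
    is_equivalence (twist_functor Hm).
Proof.
exists (@twist_is_superlie k), (@twist_is_involutive_aut k), (@twist_is_mor k).
pose F := twist_obj (@twist_is_involutive_aut k).
exists (untwist_functor hk); split; constructor.
- have fwd (A : bigraded_lie k) :
      @is_lie_mor _ _ _ (untwist_obj hk (F A)) A id.
    split=> // [g v|a b]; first by rewrite untwist_twist_deg.
    exact: untwist_twist_br.
  have bwd (A : bigraded_lie k) :
      @is_lie_mor _ _ _ A (untwist_obj hk (F A)) id.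
    split=> // [g v|a b]; first by rewrite untwist_twist_deg.
    by rewrite [RHS]untwist_twist_br.
  by unshelve eexists; [move=> A; exact: LieMor (fwd A)|
    move=> A; exact: LieMor (bwd A)|..] => *; apply: lie_mor_eq.
have fwd (S : superlie_inv k) :
    is_superlie_inv_mor (F (untwist_obj hk S)) S id.
  split=> [|v]; last exact: twist_untwist_inv.
  split=> // [p v|a b]; first by rewrite -(@twist_untwist_deg k hk S).
  exact: twist_untwist_br.
have bwd (S : superlie_inv k) :
    is_superlie_inv_mor S (F (untwist_obj hk S)) id.
  split=> [|v]; last by rewrite [RHS]twist_untwist_inv.
  split=> // [p v|a b]; first by rewrite -(@twist_untwist_deg k hk S).
  by rewrite [RHS]twist_untwist_br.
by unshelve eexists; [move=> S; exact: SuperlieInvMor (fwd S)|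
  move=> S; exact: SuperlieInvMor (bwd S)|..] => *; apply: si_mor_eq.
Qed.
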